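(* Let $G$ be a finite simple hypergraph on the vertex set $V=\{x_1,\dots,x_n\}$, all of whose edges have cardinality at least two, let $K$ be a field, let $S=K[x_1,\dots,x_n]$, let $J=J(G)\subseteq S$ be the cover ideal of $G$, and let $s$ be a positive integer. Let $P=(x_{i_1},\dots,x_{i_r})$ be a prime ideal of $S$ generated by a set of variables. Then $P\in\operatorname{Ass}(S/J^s)$ if and only if there is a subset $T$ of the vertices of the $s$-th expansion $G^s$ such that the induced sub-hypergraph $G^s_T$ is critically $(s+1)$-chromatic, and $T$ contains at least one flavor of each of the variables $x_{i_1},\dots,x_{i_r}$ but no flavors of any other variable.
   Context: A hypergraph is a pair $G=(V,E)$ where $V$ is a set of vertices and $E\subseteq 2^V$ is a set of edges; it is simple if no edge contains another edge. For $W\subseteq V$, the induced sub-hypergraph $G_W$ has vertex set $W$ and edge set $\{e\in E: e\subseteq W\}$. A vertex cover of $G$ is a set $w\subseteq V$ with $w\cap e\neq\varnothing$ for every edge $e$. A set of vertices is identified with the squarefree monomial that is the product of its elements. The cover ideal is $J(G)=(w : w\text{ is a vertex cover of }G)\subseteq S$. A $k$-coloring of a hypergraph is an assignment of colors $c_1,\dots,c_k$ to the vertices such that every edge of cardinality at least 2 contains two vertices with different colors. The chromatic number $\chi$ is the least $k$ for which a $k$-coloring exists. A hypergraph $H$ is critically $d$-chromatic if $\chi(H)=d$ and every proper induced sub-hypergraph of $H$ (on a proper subset of its vertices) has chromatic number less than $d$. For a positive integer $s$, the $s$-th expansion $G^s$ of $G$ is the hypergraph on the vertex set $\{x_{i,j}: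 1\le i\le n,\ 1\le j\le s\}$, where $x_{i,1},\dots,x_{i,s}$ are called the flavors of $x_i$. Its edges are: all pairs $\{x_{i,j},x_{i,k}\}$ with $1\le i\le n$ and $1\le j<k\le s$; and, for every edge $\{x_{l_1},\dots,x_{l_p}\}$ of $G$ (with $x_{l_1},\dots,x_{l_p}$ distinct) and every choice of $j_1,\dots,j_p\in\{1,\dots,s\}$, the set $\{x_{l_1,j_1},\dots,x_{l_p,j_p}\}$. *)

(* Defs.v *)
From HB Require Import structures.
From mathcomp Require Import all_boot all_order all_algebra.
From mathcomp Require Import mpoly.

Set Implicit Arguments.
Unset Strict Implicit.
Unset Printing Implicit Defensive.

Import GRing.Theory.
Local Open Scope ring_scope.

(* The vertices are a subset of an ambient finite type, so that a hypergraph *)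
(* and its induced sub-hypergraphs inhabit the same type.                     *)
Record hypergraph (U : finType) := Hypergraph {
  vertices : {set U};
  edges : {set {set U}};
  edges_sub : edges \subset powerset vertices
}.

Section Hypergraphs.
Variable U : finType.
Implicit Types (G H : hypergraph U) (e w W : {set U}).

Definition simple_hypergraph G : Prop :=
  {in edges G &, forall e1 e2, e1 \subset e2 -> e1 = e2}.

Fact induced_sub G W :
  [set e in edges G | e \subset W] \subset powerset (vertices G :&: W).
Proof.
apply/subsetP=> e; rewrite !inE subsetI => /andP[eG ->].
by rewrite andbT -powersetE (subsetP (edges_sub G)).
Qed.

(* G_W; the intersection is W itself whenever W is a set of vertices of G. *)
Definition induced G W : hypergraph U := Hypergraph (induced_sub G W).

Definition vertex_cover G w : Prop :=
  w \subset vertices G /\ {in edges G, forall e, w :&: e != set0}.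

Definition is_coloring H k (c : {ffun {x | x \in vertices H} -> 'I_k}) : bool :=
  [forall e in edges H, (1 < #|e|)%N ==>
    [exists x, exists y, [&& val x \in e, val y \in e & c x != c y]]].

Definition colorable H k : bool :=
  [exists c : {ffun {x | x \in vertices H} -> 'I_k}, is_coloring c].

Fact ex_colorable H : exists k, colorable H k.
Proof.
exists #|{: {x | x \in vertices H}}|.
apply/existsP; exists [ffun x => enum_rank x].
apply/'forall_implyP=> e eH; apply/implyP=> /card_gt1P[x [y [xe ye xy]]].
have /subsetP eV : e \subset vertices H.
  by rewrite -powersetE (subsetP (edges_sub H)).
apply/existsP; exists (Sub x (eV x xe)); apply/existsP; exists (Sub y (eV y ye)).
by rewrite !SubK xe ye !ffunE (inj_eq enum_rank_inj) -val_eqE.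
Qed.

Definition chromatic_number H : nat := ex_minn (ex_colorable H).

Definition critically_chromatic d H : Prop :=
  chromatic_number H = d /\
  (forall W, W \proper vertices H -> (chromatic_number (induced H W) < d)%N).

Section Expansion.
Variables (G : hypergraph U) (s : nat).

(* The vertex (x, j) is the j-th flavor of x. *)
Definition expansion_vertices : {set U * 'I_s} := setX (vertices G) [set: 'I_s].

Definition flavor_edges : {set {set U * 'I_s}} :=
  [set [set (x, jk.1); (x, jk.2)] |
    x in vertices G, jk in [set jk : 'I_s * 'I_s | (jk.1 < jk.2)%N]].

(* A choice of flavors on an edge is the restriction of a function f on U. *)
Definition lifted_edges : {set {set U * 'I_s}} :=
  [set [set (x, (f : {ffun U -> 'I_s}) x) | x in (e : {set U})] |
    e in edges G, f in [set: {ffun U -> 'I_s}]].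

Fact expansion_sub :
  flavor_edges :|: lifted_edges \subset powerset expansion_vertices.
Proof.
apply/subsetP=> a /setUP[]/imset2P[].
  move=> x jk xV _ ->; rewrite powersetE; apply/subsetP=> y.
  by rewrite /expansion_vertices !inE => /orP[]/eqP->; rewrite xV.
move=> e f eG _ ->; rewrite powersetE; apply/subsetP=> y /imsetP[x xe ->].
rewrite /expansion_vertices in_setX in_setT andbT /=.
have : e \subset vertices G by rewrite -powersetE (subsetP (edges_sub G)).
by move/subsetP; apply.
Qed.

Definition expansion : hypergraph (U * 'I_s)%type := Hypergraph expansion_sub.

End Expansion.
End Hypergraphs.

Section Ideals.
Variable R : comNzRingType.
Implicit Types (A I P : R -> Prop).

Definition is_ideal I : Prop :=
  [/\ I 0, (forall a b, I a -> I b -> I (a + b)) & forall a b, I b -> I (a * b)].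

Definition prime_ideal P : Prop :=
  [/\ is_ideal P, ~ P 1 & forall a b, P (a * b) -> P a \/ P b].

Definition generated_ideal A : R -> Prop := fun f =>
  exists2 r : seq (R * R),
    (forall p, p \in r -> A p.2) & f = \sum_(p <- r) p.1 * p.2.

Definition ideal_power I s : R -> Prop :=
  generated_ideal (fun f =>
    exists2 t : 'I_s -> R, (forall i, I (t i)) & f = \prod_i t i).

(* The annihilator of the class of f in R / I. *)
Definition class_annihilator I (f : R) : R -> Prop := fun g => I (g * f).

(* Membership of P in Ass (R / I), R / I being viewed as an R-module. *)
Definition associated_prime I P : Prop :=
  prime_ideal P /\ exists f, forall g, P g <-> class_annihilator I f g.

End Ideals.

Section CoverIdeal.
Variables (K : fieldType) (n : nat).

Definition set_monomial (w : {set 'I_n}) : {mpoly K[n]} := \prod_(i in w) 'X_i.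

Definition cover_ideal (G : hypergraph 'I_n) : {mpoly K[n]} -> Prop :=
  generated_ideal (fun m => exists2 w, vertex_cover G w & m = set_monomial w).

Definition variables_ideal (A : {set 'I_n}) : {mpoly K[n]} -> Prop :=
  generated_ideal (fun m => exists2 i, i \in A & m = 'X_i).

End CoverIdeal.

(* Main.v *)
(* A monomial x^a lies in J^s exactly when there are s vertex covers of G in   *)
(* which every vertex x occurs at most a(x) times. An s-coloring of G^s_T is a *)
(* family of s independent sets of G in which x occurs at least t(x) times,    *)
(* t(x) being the number of flavors of x in T, and taking complements shows    *)
(* that it exists if and only if x^(s - t) lies in J^s. Thus G^s_T is          *)
(* critically (s+1)-chromatic exactly when x^(s - t) is not in J^s but each    *)
(* x_i x^(s - t) with t(i) > 0 is. Since exponents above s are irrelevant for  *)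
(* membership in J^s, this means that P annihilates the class of x^(s - t).    *)
(* Conversely, if P = J^s : f, multiply f by the s-th power of the product of  *)
(* the variables outside P; some monomial x^b of f stays outside J^s, and T    *)
(* takes s - b(x) flavors of each variable x of P.                             *)

Require Import Defs.
From HB Require Import structures.
From mathcomp Require Import all_boot all_order all_algebra.
From mathcomp Require Import mpoly zify.

Set Implicit Arguments.
Unset Strict Implicit.
Unset Printing Implicit Defensive.

(** Both sides of the equivalence reduce to [dominates_covers]. On the algebraic side all ideals
    involved are monomial, so [cover_ideal_powerP] and [variables_idealP] read membership off
    exponents. On the coloring side, [colorable_expansion] works because the edges between flavors
    give the flavors of one vertex distinct colors, while the lifted edges make each color class
    project to an independent set, whose complement is a cover. Deleting a flavor of x from T raises
    the exponent of x by one; hence [critically_chromatic_expansion] turns criticality into a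
    statement about one monomial and its multiples by single variables. Truncating exponents at s
    ([dominates_covers_min]) disposes of the variables outside P in both directions. *)

(** * Colorings and critical hypergraphs *)

Definition proper_coloring (U : finType) (H : hypergraph U) k (d : U -> 'I_k) :=
  forall e, e \in edges H -> 1 < #|e| ->
  exists x y, [/\ x \in e, y \in e & d x != d y].

Lemma edge_subset (U : finType) (H : hypergraph U) e :
  e \in edges H -> e \subset vertices H.
Proof. by move=> eH; rewrite -powersetE (subsetP (edges_sub H)). Qed.

(** Edges consist of vertices, so colors elsewhere are irrelevant and a coloring may be total on
    [U]; [0 < k] supplies the default color. *)
Lemma colorableP (U : finType) (H : hypergraph U) k : 0 < k ->
  reflect (exists d : U -> 'I_k, proper_coloring H d) (colorable H k).
Proof.
move=> k_gt0; apply: (iffP existsP) => [[c]|[d dP]].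
  move=> /'forall_implyP cP.
  exists (fun x => if insub x is Some u then c u else Ordinal k_gt0) => e eH e1.
  have /existsP[x /existsP[y /and3P[xe ye xy]]] := implyP (cP e eH) e1.
  by exists (val x), (val y); split; rewrite ?valK.
exists [ffun x => d (val x)]; apply/'forall_implyP=> e eH; apply/implyP=> e1.
have [x [y [xe ye xy]]] := dP e eH e1.
have /subsetP eV := edge_subset eH.
apply/existsP; exists (Sub x (eV x xe)).
apply/existsP; exists (Sub y (eV y ye)).
by rewrite !ffunE !SubK xe ye.
Qed.

Lemma colorable_edges (U : finType) (H H' : hypergraph U) k : 0 < k ->
  edges H = edges H' -> colorable H k = colorable H' k.
Proof.
move=> k_gt0 eHH'; apply/(sameP (colorableP _ k_gt0))/(iffP (colorableP _ k_gt0)).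
  by case=> d dP; exists d => e; rewrite eHH'; apply: dP.
by case=> d dP; exists d => e; rewrite -eHH'; apply: dP.
Qed.

Lemma leq_colorable (U : finType) (H : hypergraph U) k k' :
  k <= k' -> colorable H k -> colorable H k'.
Proof.
move=> le_kk' /existsP[c /'forall_implyP cP].
apply/existsP; exists [ffun x => widen_ord le_kk' (c x)].
apply/'forall_implyP=> e eH; apply/implyP=> e1.
have /existsP[x /existsP[y xyP]] := implyP (cP e eH) e1.
by apply/existsP; exists x; apply/existsP; exists y; rewrite !ffunE.
Qed.

Lemma chromatic_number_leq (U : finType) (H : hypergraph U) k :
  (chromatic_number H <= k) = colorable H k.
Proof.
rewrite /chromatic_number; case: ex_minnP => m mP min_m.
by apply/idP/idP => [/leq_colorable|]; [apply | apply: min_m].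
Qed.

(** A proper subset of the vertices misses some vertex v, and a coloring of H - v restricts to it;
    so deleting single vertices is enough. One extra color for v shows that H itself needs at most k
    + 1 colors. *)
Lemma critically_chromaticP (U : finType) (H : hypergraph U) k : 0 < k ->
  critically_chromatic k.+1 H <->
  ~~ colorable H k /\
  {in vertices H, forall v, colorable (induced H (vertices H :\ v)) k}.
Proof.
move=> k_gt0; split=> [[chi_H crit_H]|[ncol_H col_Hv]].
  split=> [|v vH]; first by rewrite -chromatic_number_leq chi_H ltnn.
  by rewrite -chromatic_number_leq -ltnS crit_H ?properD1.
have [v vH] : exists v, v \in vertices H.
  apply/set0Pn; apply: contraNneq ncol_H => H0; apply/(colorableP _ k_gt0).
  exists (fun=> Ordinal k_gt0) => e /edge_subset.
  by rewrite H0 subset0 => /eqP->; rewrite cards0.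
split=> [|W].
  apply/eqP; rewrite eqn_leq ltnNge !chromatic_number_leq ncol_H andbT.
  have /(colorableP _ k_gt0)[d dP] := col_Hv v vH.
  apply/(colorableP _ (ltn0Sn k)).
  (* The new color [ord_max] is used at [v] only, so an edge through [v] is bichromatic as soon as
     it has a second vertex. *)
  exists (fun u => if u == v then ord_max else widen_ord (leqnSn k) (d u)) => e eH e1.
  have [ve|vNe] := boolP (v \in e).
    have [x] : exists x, x \in e :\ v.
      by apply/set0Pn; rewrite -card_gt0; move: e1; rewrite (cardsD1 v) ve.
    rewrite !inE => /andP[/negPf xv xe]; exists v, x; split=> //.
    rewrite eqxx xv; apply/eqP => /(congr1 val) /= dx.
    by have := ltn_ord (d x); rewrite -dx ltnn.
  have [|x [y [xe ye xy]]] := dP e _ e1.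
    by rewrite inE eH subsetD1 vNe andbT edge_subset.
  exists x, y; split=> //.
  have /negPf-> : x != v by apply: contraNneq vNe => <-.
  by have /negPf-> : y != v by apply: contraNneq vNe => <-.
move=> /properP[sWH [u uH uNW]]; rewrite ltnS chromatic_number_leq.
have /(colorableP _ k_gt0)[d dP] := col_Hv u uH.
apply/(colorableP _ k_gt0); exists d => e; rewrite inE => /andP[eH eW].
apply: dP; rewrite inE eH subsetD1 edge_subset //=.
by apply: contra uNW; apply: subsetP.
Qed.

(** * Families of vertex covers *)

Definition is_cover (U : finType) (G : hypergraph U) (w : {set U}) :=
  [forall e in edges G, w :&: e != set0].

(* These are the exponents [a] for which [x^a] lies in [J(G)^s]. *)
Definition dominates_covers (U : finType) (G : hypergraph U) s (a : U -> nat) :=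
  [exists w : {ffun 'I_s -> {set U}}, [forall j, is_cover G (w j)] &&
    [forall x, #|[set j | x \in w j]| <= a x]].

Lemma dominates_coversP (U : finType) (G : hypergraph U) s (a : U -> nat) :
  reflect (exists2 w : 'I_s -> {set U}, forall j, is_cover G (w j) &
             forall x, #|[set j | x \in w j]| <= a x)
          (dominates_covers G s a).
Proof.
apply: (iffP existsP) => [[w /andP[/forallP wG /forallP wa]]|[w wG wa]].
  by exists w.
exists (finfun w); apply/andP; split; apply/forallP => x.
  by rewrite ffunE.
by under eq_finset do rewrite ffunE.
Qed.

(* A cover family uses each vertex at most [s] times. *)
Lemma dominates_covers_min (U : finType) (G : hypergraph U) s (a b : U -> nat) :
  (forall x, minn (a x) s <= b x) ->
  dominates_covers G s a -> dominates_covers G s b.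
Proof.
move=> le_ab /dominates_coversP[w wG wa]; apply/dominates_coversP; exists w => // x.
apply: leq_trans (le_ab x); rewrite leq_min wa.
by rewrite -[leqRHS]card_ord max_card.
Qed.

(** * Colorings of the expansion *)

Definition flavors (U : finType) s (T : {set U * 'I_s}) x := [set k | (x, k) \in T].

Lemma flavor_edge (U : finType) (G : hypergraph U) s x (j k : 'I_s) :
  x \in vertices G -> j != k -> [set (x, j); (x, k)] \in edges (expansion G s).
Proof.
move=> xG; wlog lt_jk : j k / j < k => [IH jk|_].
  have [jk'|kj|/val_inj eq_jk] := ltngtP j k; first exact: IH.
    by rewrite setUC IH // eq_sym.
  by rewrite eq_jk eqxx in jk.
rewrite inE; apply/orP; left; apply/imset2P.
by exists x (j, k); rewrite ?inE.
Qed.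

Lemma lifted_edge (U : finType) (G : hypergraph U) s (f : U -> 'I_s) e :
  e \in edges G -> [set (x, f x) | x in e] \in edges (expansion G s).
Proof.
move=> eG; rewrite inE; apply/orP; right; apply/imset2P.
exists e (finfun f); rewrite ?inE //.
by apply: eq_imset => x; rewrite ffunE.
Qed.

Lemma card_leq_inj_in (T1 T2 : finType) (A : {set T1}) (B : {set T2}) (y0 : T2) :
  #|A| <= #|B| ->
  exists f : T1 -> T2, {in A, forall x, f x \in B} /\ {in A &, injective f}.
Proof.
move=> le_AB.
have idxP x : x \in A -> index x (enum A) < size (enum B).
  move=> xA; rewrite -cardE; apply: leq_trans le_AB.
  by rewrite cardE index_mem mem_enum.
exists (fun x => nth y0 (enum B) (index x (enum A))); split=> [x xA|x y xA yA].
  by rewrite -mem_enum mem_nth ?idxP.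
move/eqP; rewrite nth_uniq ?idxP ?enum_uniq // => /eqP.
by apply: (@index_inj _ x (enum A)); rewrite mem_enum.
Qed.

(* The color classes of [G^s_T] project to independent sets of [G]; the cover *)
(* family consists of their complements.                                     *)
Lemma colorable_expansion (U : finType) (G : hypergraph U) s
    (T : {set U * 'I_s}) :
  vertices G = [set: U] -> (forall e, e \in edges G -> 1 < #|e|) -> 0 < s ->
  colorable (induced (expansion G s) T) s =
  dominates_covers G s (fun x => s - #|flavors T x|).
Proof.
move=> GT G1 s_gt0.
have sub_card (w : {set 'I_s}) x : (#|~: w| <= s - #|flavors T x|) = (#|flavors T x| <= #|w|).
  rewrite leq_subRL; last by rewrite (leq_trans (max_card _)) ?card_ord.
  by have := leq_add2r #|~: w| #|flavors T x| #|w|; rewrite cardsC card_ord.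
apply/(sameP (colorableP _ s_gt0))/(iffP (dominates_coversP _ _ _)).
  case=> w wG wT.
  (* The flavors of x lying in T receive distinct colors j, chosen among the indices whose cover
     avoids x; the multiplicity bound leaves enough of them. *)
  have /fin_all_exists[d dP] x : exists f : 'I_s -> 'I_s,
      {in flavors T x, forall k, f k \in [set j | x \notin w j]} /\
      {in flavors T x &, injective f}.
    apply: card_leq_inj_in (Ordinal s_gt0) _; rewrite -sub_card.
    by apply: leq_trans (wT x); apply: subset_leq_card; apply/subsetP=> j; rewrite !inE negbK.
  exists (fun xk => d xk.1 xk.2).
  move=> e; rewrite inE => /andP[+ eT] e1; rewrite inE => /orP[]/imset2P[].
    move=> x [j k] xG; rewrite inE /= => lt_jk e_eq.
    have [xjT xkT] : (x, j) \in T /\ (x, k) \in T.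
      by split; apply: (subsetP eT); rewrite e_eq !inE eqxx ?orbT.
    exists (x, j), (x, k); rewrite e_eq !inE !eqxx ?orbT; split=> //=.
    apply: contraL lt_jk => /eqP/((dP x).2 j k); rewrite !inE => -> //.
    by rewrite ltnn.
  move=> f g fG _ e_eq.
  have [x xf] : exists x, x \in f by apply/set0Pn; rewrite -card_gt0 ltnW ?G1.
  (* The cover indexed by the color of x meets the edge at some y; the color of y is an index whose
     cover avoids y, so the two colors differ. *)
  have /forall_inP/(_ f fG)/set0Pn[y] := wG (d x (g x)).
  rewrite inE => /andP[yw yf].
  exists (x, g x), (y, g y); split; first by rewrite e_eq; apply/imsetP; exists x.
    by rewrite e_eq; apply/imsetP; exists y.
  apply: contraTneq yw => /= ->.
  suff /((dP y).1 (g y)) : g y \in flavors T y by rewrite inE.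
  by rewrite inE (subsetP eT) // e_eq; apply/imsetP; exists y.
case=> d dP.
(* The j-th cover is the complement of the projection of color class j. *)
exists (fun j => [set x | [forall k, ((x, k) \in T) ==> (d (x, k) != j)]]) => [j|x].
  apply/forall_inP => e eG; apply/set0Pn.
  have [/existsP[x /andP[xe xw]]|/existsPn ew] :=
    boolP [exists x, (x \in e) && [forall k, ((x, k) \in T) ==> (d (x, k) != j)]].
    by exists x; rewrite !inE xw.
  (* If the edge missed this cover, each of its vertices would have a flavor in T of color j, and
     these flavors would form a monochromatic edge. The default [j] is never reached on [e]. *)
  pose f x := odflt j [pick k | ((x, k) \in T) && (d (x, k) == j)].
  have fP x : x \in e -> (x, f x) \in T /\ d (x, f x) = j.
    move=> xe; have := ew x; rewrite xe /= => /forallPn[k].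
    rewrite negb_imply negbK => kP.
    rewrite /f; case: pickP => [k' /andP[? /eqP]//|/(_ k)].
    by rewrite kP.
  have [||p [q [/imsetP[x xe ->] /imsetP[y ye ->]]]] := dP [set (x, f x) | x in e].
  - rewrite inE lifted_edge //=; apply/subsetP => _ /imsetP[x xe ->].
    by case: (fP x xe).
  - by rewrite card_imset ?G1 // => x y [].
  by rewrite (fP x xe).2 (fP y ye).2 eqxx.
(* Distinct flavors of x have distinct colors, and none of these colors indexes a cover containing
   x. *)
rewrite -[X in #|pred_of_set X|]setCK sub_card.
rewrite -(@card_in_imset _ _ (fun k => d (x, k))).
  apply: subset_leq_card; apply/subsetP => _ /imsetP[k kT ->].
  rewrite !inE; apply/forallPn; exists k.
  by move: kT; rewrite inE => ->; rewrite eqxx.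
move=> j k; rewrite !inE => xjT xkT djk; apply/eqP; apply: contraT => jk.
have [||p [q []]] := dP [set (x, j); (x, k)].
- rewrite inE flavor_edge ?GT //=.
  by apply/subsetP => y; rewrite !inE => /orP[]/eqP->.
- by rewrite cards2 xpair_eqE eqxx /= jk.
by rewrite !inE => /orP[]/eqP-> /orP[]/eqP->; rewrite ?djk eqxx.
Qed.

(** * Membership in monomial ideals *)

Section MonomialIdeals.
Import GRing.Theory.
Local Open Scope ring_scope.

Lemma generated_ideal_is_ideal (R : comNzRingType) (A : R -> Prop) :
  is_ideal (generated_ideal A).
Proof.
split=> [|a b [r rA ->] [r' r'A ->]|a b [r rA ->]].
- by exists [::]; rewrite ?big_nil.
- exists (r ++ r'); last by rewrite big_cat.
  by move=> p; rewrite mem_cat => /orP[/rA|/r'A].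
- exists [seq (a * p.1, p.2) | p <- r].
    by move=> _ /mapP[p pr ->]; apply: rA p pr.
  by rewrite big_map mulr_sumr; apply: eq_bigr => p _; rewrite mulrA.
Qed.

Lemma mem_generated_ideal (R : comNzRingType) (A : R -> Prop) a :
  A a -> generated_ideal A a.
Proof.
move=> Aa; exists [:: (1, a)]; last by rewrite big_seq1 mul1r.
by move=> p; rewrite inE => /eqP->.
Qed.

Lemma generated_ideal_mull (R : comNzRingType) (A : R -> Prop) a b :
  A b -> generated_ideal A (a * b).
Proof.
move=> Ab; have [_ _ IM] := generated_ideal_is_ideal A.
exact/IM/mem_generated_ideal.
Qed.

Lemma generated_ideal_min (R : comNzRingType) (A I : R -> Prop) f :
  is_ideal I -> (forall a, A a -> I a) -> generated_ideal A f -> I f.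
Proof.
move=> [I0 ID IM] AI [r rA ->]; rewrite big_seq.
by apply: big_ind => // p pr; apply/IM/AI/rA.
Qed.

Variables (K : fieldType) (n : nat).
Implicit Types (f g : {mpoly K[n]}) (m : 'X_{1..n}).

(** The polynomials supported on [N] form an ideal because [N] is stable under multiplication by
    monomials. This serves for the cover ideal, its powers and the ideals of variables alike. *)
Lemma generated_monomialsP (B : {mpoly K[n]} -> Prop) (N : 'X_{1..n} -> Prop) :
    (forall m m', N m -> N (m' + m)%MM) ->
    (forall b m, B b -> m \in msupp b -> N m) ->
    (forall m, N m -> generated_ideal B 'X_[m]) ->
  forall f, generated_ideal B f <-> (forall m, m \in msupp f -> N m).
Proof.
move=> NS BN NB f; split.
  apply: (generated_ideal_min (I := fun f => forall m, m \in msupp f -> N m)).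
    split=> [m|a b aN bN m /msuppD_le|a b bN m /msuppM_le/allpairsP[[m1 m2] /=]].
    - by rewrite mcoeff_msupp mcoeff0 eqxx.
    - by rewrite mem_cat => /orP[/aN|/bN].
    - by move=> [_ /bN Nm2 ->]; apply: NS.
  by move=> b Bb m; apply: BN.
have [G0 GD GM] := generated_ideal_is_ideal B.
move=> fN; rewrite [f]mpolyE big_seq; apply: big_ind => // m /fN/NB Nm.
by rewrite -mul_mpolyC; apply: GM.
Qed.

Lemma set_monomialE (w : {set 'I_n}) :
  set_monomial K w = 'X_[(\sum_(i in w) U_(i))%MM].
Proof. by rewrite (big_morph _ (@mpolyXD n K) (@mpolyX0 n K)). Qed.

Lemma sum_mnm1E (w : {set 'I_n}) j : (\sum_(i in w) U_(i))%MM j = (j \in w).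
Proof.
rewrite mnm_sumE; under eq_bigr do rewrite mnm1E.
have [jw|jw] := boolP (j \in w); last first.
  by rewrite big1 // => i iw; rewrite (_ : _ == _ = false) //; apply: contraNF jw => /eqP <-.
by rewrite (bigD1 j) //= eqxx big1 // => i /andP[_ /negPf->].
Qed.

Lemma vertex_coverE (G : hypergraph 'I_n) w : vertices G = [set: 'I_n] ->
  vertex_cover G w <-> is_cover G w.
Proof.
rewrite /vertex_cover => ->; split=> [[_ wG]|/forall_inP wG].
  exact/forall_inP.
by rewrite subsetT; split.
Qed.

Lemma cover_idealP (G : hypergraph 'I_n) f : vertices G = [set: 'I_n] ->
  cover_ideal (K := K) G f <->
  (forall m, m \in msupp f ->
     exists2 w, is_cover G w & forall i, ((i \in w) <= m i)%N).
Proof.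
move=> GT; apply: generated_monomialsP => [m m' [w wG wm]|_ m [w /vertex_coverE wG ->]|m].
- exists w => // i; apply: leq_trans (wm i) _.
  by rewrite mnmDE leq_addl.
- rewrite set_monomialE => /mem_msuppXP <-; exists w; first exact: wG.
  by move=> i; rewrite sum_mnm1E.
move=> [w wG wm].
(* The monomial is divisible by that of the cover, and is rewritten as quotient times divisor. *)
have /submK <- : ((\sum_(i in w) U_(i)) <= m)%MM.
  by apply/mnm_lepP => i; rewrite sum_mnm1E.
rewrite mpolyXD -set_monomialE; apply: generated_ideal_mull.
by exists w => //; apply/vertex_coverE.
Qed.

Lemma msupp_prod s (t : 'I_s -> {mpoly K[n]}) m :
  m \in msupp (\prod_i t i) ->
  exists2 a : 'I_s -> 'X_{1..n}, forall i, a i \in msupp (t i) &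
    m = (\sum_i a i)%MM.
Proof.
elim: s => [|s IHs] in t m *.
  rewrite big_ord0 msupp1 inE => /eqP->.
  by exists (fun=> 0%MM) => [[]|]; rewrite ?big_ord0.
rewrite big_ord_recl => /msuppM_le/allpairsP[[m1 m2] /= [m1t /IHs[a aP ->] ->]].
exists (fun i => if unlift ord0 i is Some j then a j else m1) => [i|].
  by case: unliftP => [j ->|->].
rewrite big_ord_recl unlift_none; congr (_ + _)%MM.
by apply: eq_bigr => j _; rewrite liftK.
Qed.

Lemma card_multiplicity (T : finType) s (w : 'I_s -> {set T}) x :
  #|[set j | x \in w j]| = (\sum_j (x \in w j))%N.
Proof. by rewrite -sum1dep_card big_mkcond; apply: eq_bigr => j _; case: in_mem. Qed.

Lemma cover_ideal_powerP (G : hypergraph 'I_n) s f : vertices G = [set: 'I_n] ->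
  ideal_power (cover_ideal (K := K) G) s f <->
  (forall m, m \in msupp f -> dominates_covers G s m).
Proof.
move=> GT; apply: generated_monomialsP => [m m'|_ m [t tJ ->]|m].
- apply: dominates_covers_min => i.
  by rewrite mnmDE; apply: leq_trans (geq_minl _ _) (leq_addl _ _).
- move=> /msupp_prod[a aP ->].
  have /fin_all_exists2[w wG wa] j :
    exists2 w, is_cover G w & forall i, ((i \in w) <= a j i)%N.
    by have /cover_idealP := tJ j; apply.
  apply/dominates_coversP; exists w => // i.
  by rewrite card_multiplicity mnm_sumE; apply: leq_sum => j _.
move=> /dominates_coversP[w wG wm].
have /submK <- : ((\sum_j \sum_(i in w j) U_(i)) <= m)%MM.
  apply/mnm_lepP => i; rewrite mnm_sumE; apply: leq_trans (wm i).
  by rewrite card_multiplicity leq_sum // => j _; rewrite sum_mnm1E.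
rewrite mpolyXD; apply: generated_ideal_mull.
exists (fun j => set_monomial K (w j)) => [j|].
  by apply: mem_generated_ideal; exists (w j) => //; apply/vertex_coverE.
rewrite (big_morph _ (@mpolyXD n K) (@mpolyX0 n K)).
by apply: eq_bigr => j _; rewrite set_monomialE.
Qed.

Lemma variables_idealP (A : {set 'I_n}) f :
  variables_ideal (K := K) A f <->
  (forall m, m \in msupp f -> [exists i in A, 0 < m i]%N).
Proof.
apply: generated_monomialsP => [m m' /exists_inP[i iA mi]|_ m [i iA ->]|m].
- by apply/exists_inP; exists i; rewrite // mnmDE addn_gt0 mi orbT.
- by move=> /mem_msuppXP <-; apply/exists_inP; exists i; rewrite // mnm1E eqxx.
move=> /exists_inP[i iA mi].
have /submK <- : (U_(i) <= m)%MM.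
  by apply/mnm_lepP => j; rewrite mnm1E; case: eqP => // <-.
by rewrite mpolyXD; apply: generated_ideal_mull; exists i.
Qed.

(** * Primality of ideals generated by variables *)

Definition kill_variables (A : {set 'I_n}) f : {mpoly K[n]} :=
  f \mPo [tuple if i \in A then 0 else 'X_i | i < n].

Lemma kill_variablesX (A : {set 'I_n}) m :
  kill_variables A 'X_[m] = if [exists i in A, 0 < m i]%N then 0 else 'X_[m].
Proof.
rewrite /kill_variables comp_mpolyX; case: ifPn => [/exists_inP[i iA mi]|].
  by rewrite (bigD1 i) //= tnth_mktuple iA expr0n gtn_eqF // mul0r.
rewrite negb_exists_in => /forall_inP mA.
rewrite mpolyXE_id; apply: eq_bigr => i _; rewrite tnth_mktuple.
by case: ifPn => // /mA; rewrite -eqn0Ngt => /eqP->; rewrite !expr0.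
Qed.

(** Setting the variables of [A] to zero kills the monomials that involve them and fixes all others.
    The ideal is thus the kernel of a ring morphism into an integral domain, hence prime. *)
Lemma kill_variables_eq0 (A : {set 'I_n}) f :
  variables_ideal (K := K) A f <-> kill_variables A f = 0.
Proof.
rewrite variables_idealP.
have -> : kill_variables A f =
    \sum_(m <- msupp f) f@_m *: kill_variables A 'X_[m].
  exact: comp_mpolyEX.
split=> [fA|f0 m mf].
  by rewrite big_seq big1 // => m /fA mA; rewrite kill_variablesX mA scaler0.
apply: contraTT mf => mA; rewrite mcoeff_msupp negbK.
have := congr1 (mcoeff m) f0; rewrite mcoeff0 => <-.
rewrite {1}[f]mpolyE !raddf_sum /=; apply/eqP/eq_bigr => m' _.
rewrite !mcoeffZ kill_variablesX; case: ifPn => // m'A.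
rewrite mcoeff0 mcoeffX (_ : _ == _ = false) //.
by apply: contraNF mA => /eqP <-.
Qed.

Lemma variables_ideal_prime (A : {set 'I_n}) :
  prime_ideal (variables_ideal (K := K) A).
Proof.
split=> [||f g]; first exact: generated_ideal_is_ideal.
  move=> /kill_variables_eq0 /eqP; rewrite /kill_variables comp_mpoly1.
  by rewrite oner_eq0.
move=> /kill_variables_eq0; rewrite /kill_variables rmorphM => /eqP.
by rewrite mulf_eq0 => /orP[]/eqP ?; [left|right]; apply/kill_variables_eq0.
Qed.

End MonomialIdeals.

(** * Criticality in terms of exponents, and the equivalence *)

Lemma critically_chromatic_expansion (U : finType) (G : hypergraph U) s
    (T : {set U * 'I_s}) :
  vertices G = [set: U] -> (forall e, e \in edges G -> 1 < #|e|) -> 0 < s ->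
  critically_chromatic s.+1 (induced (expansion G s) T) <->
  ~~ dominates_covers G s (fun x => s - #|flavors T x|) /\
  (forall x, 0 < #|flavors T x| ->
     dominates_covers G s (fun y => s - #|flavors T y| + (x == y))).
Proof.
move=> GT G1 s_gt0; rewrite critically_chromaticP // colorable_expansion //.
have -> : vertices (induced (expansion G s) T) = T.
  by apply/setP => [[x k]]; rewrite !inE GT inE.
have colT v : colorable (induced (induced (expansion G s) T) (T :\ v)) s =
    dominates_covers G s (fun x => s - #|flavors (T :\ v) x|).
  rewrite -colorable_expansion //; apply: colorable_edges => //.
  apply/setP=> e; rewrite !inE -andbA; congr (_ && _).
  by apply: andb_idl => /subset_trans; apply; rewrite subsetDl.
(* At most s flavors exist, so the truncated subtraction is exact and losing one flavor adds exactly
   one. *)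
have flavorsD x k y : (x, k) \in T ->
    s - #|flavors (T :\ (x, k)) y| = s - #|flavors T y| + (x == y).
  move=> xkT; have [<-|xy] := eqVneq x y.
    have le_s : #|flavors T x| <= s by rewrite (leq_trans (max_card _)) ?card_ord.
    have -> : flavors (T :\ (x, k)) x = flavors T x :\ k.
      by apply/setP=> j; rewrite !inE xpair_eqE eqxx.
    by move: le_s; rewrite (cardsD1 k (flavors T x)) inE xkT /=; lia.
  have -> : flavors (T :\ (x, k)) y = flavors T y; last by rewrite addn0.
  by apply/setP=> j; rewrite !inE xpair_eqE eq_sym (negPf xy).
have dominates_ext (a b : U -> nat) : a =1 b ->
    dominates_covers G s a -> dominates_covers G s b.
  by move=> ab; apply: dominates_covers_min => x; rewrite ab geq_minl.
split=> [[ncol col]|[ncol col]].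
  split=> // x; rewrite card_gt0 => /set0Pn[k]; rewrite inE => xkT.
  by have := col _ xkT; rewrite colT; apply: dominates_ext => y; apply: flavorsD.
split=> // [[x k] xkT]; rewrite colT; have : 0 < #|flavors T x|.
  by rewrite card_gt0; apply/set0Pn; exists k; rewrite inE.
by move/col; apply: dominates_ext => y; rewrite flavorsD.
Qed.

Lemma card_ord_ltn s c : c <= s -> #|[set k : 'I_s | k < c]| = c.
Proof.
move=> le_cs; rewrite -sum1dep_card -(big_ord_widen _ (fun=> 1)) //.
by rewrite sum1_card card_ord.
Qed.

Theorem corollary4p7 (K : fieldType) (n : nat) (G : hypergraph 'I_n) (s : nat)
    (A : {set 'I_n})
    (G_vertices : vertices G = [set: 'I_n])
    (G_simple : simple_hypergraph G)
    (G_edges : forall e : {set 'I_n}, e \in edges G -> 1 < #|e|)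
    (s_gt0 : 0 < s) :
  associated_prime (ideal_power (cover_ideal (K := K) G) s)
                   (variables_ideal (K := K) A) <->
  (exists T : {set 'I_n * 'I_s},
     [/\ T \subset vertices (expansion G s),
         critically_chromatic s.+1 (induced (expansion G s) T),
         (forall i : 'I_n, i \in A -> exists j : 'I_s, (i, j) \in T)
       & (forall (i : 'I_n) (j : 'I_s), (i, j) \in T -> i \in A)]).
Proof.
split=> [[_ [f fP]]|[T [_ /critically_chromatic_expansion[] // ncol col AT TA]]].
  (* This monomial avoids the variables of P, so it is not in P and its product with f is not in
     J^s; some monomial of that product therefore stays outside. *)
  pose m0 := [multinom if i \in A then 0 else s | i < n].
  have [b bf ndom] : exists2 b, b \in msupp f & ~~ dominates_covers G s (m0 + b)%MM.
    apply/allPn/negP=> /allP f_dom.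
    have /variables_idealP/(_ m0) : variables_ideal (K := K) A 'X_[m0].
      apply/fP/cover_ideal_powerP => // m.
      rewrite GRing.mulrC (perm_mem (msuppMX _ _)) => /mapP[b /f_dom ? ->] //.
    move=> /(_ (introT (mem_msuppXP _ _ _) erefl))/exists_inP[i iA].
    by rewrite mnmE iA.
  have dom i : i \in A -> dominates_covers G s (U_(i) + b)%MM.
    move=> iA; have /fP/(cover_ideal_powerP _ _ G_vertices) :
        variables_ideal (K := K) A 'X_i.
      by rewrite -['X_i]GRing.mul1r; apply: generated_ideal_mull; exists i.
    apply; rewrite GRing.mulrC (perm_mem (msuppMX _ _)).
    exact: map_f.
  (* Then s - #flavors is min(b, s) on [A] and s elsewhere, which is [m0 + b] truncated at s. *)
  pose T := [set xk : 'I_n * 'I_s | (xk.1 \in A) && (xk.2 < s - b xk.1)].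
  have cardT x : #|flavors T x| = if x \in A then s - b x else 0.
    have [xA|xA] := ifPn; last first.
      by apply/eqP; rewrite cards_eq0; apply/eqP/setP => k; rewrite !inE (negPf xA).
    rewrite -[RHS](@card_ord_ltn s) ?leq_subr //.
    by apply: eq_card => k; rewrite !inE xA.
  exists T; split.
  - by apply/subsetP => [[x k]] _; rewrite inE /= G_vertices !inE.
  - apply/critically_chromatic_expansion => //; split=> [|x].
      apply: contra ndom; apply: dominates_covers_min => x.
      by rewrite cardT mnmDE mnmE; case: ifP => _; lia.
    rewrite cardT; case: ifP => // xA _.
    apply: dominates_covers_min (dom x xA) => y.
    by rewrite cardT mnmDE mnm1E; case: ifP => _; case: (x == y); lia.
  - move=> i iA; exists (Ordinal s_gt0); rewrite inE iA /= subn_gt0 ltnNge.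
    (* If b(i) were at least s, one more factor x_i would change nothing below s, so [dom] would
       contradict [ndom]. *)
    apply: contra ndom => le_sb; apply: dominates_covers_min (dom i iA) => y.
    by rewrite !mnmDE mnm1E; case: eqP => [<-|_]; lia.
  - by move=> i j; rewrite inE => /andP[].
split; first exact: variables_ideal_prime.
pose b := [multinom s - #|flavors T i| | i < n].
exists 'X_[b] => g; rewrite variables_idealP /class_annihilator.
rewrite cover_ideal_powerP //.
(* Both memberships are tested on monomials, so it suffices to compare them for a single x^m. *)
suff domE (m : 'X_{1..n}) : [exists i in A, 0 < m i] = dominates_covers G s (b + m)%MM.
  split=> [gA m|gJ m mg]; last first.
    by rewrite domE; apply: gJ; rewrite (perm_mem (msuppMX _ _)) map_f.
  by rewrite (perm_mem (msuppMX _ _)) => /mapP[m' /gA ? ->]; rewrite -domE.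
apply/exists_inP/idP => [[i /AT[j ijT] mi]|dom_bm].
  have /col : 0 < #|flavors T i|.
    by rewrite card_gt0; apply/set0Pn; exists j; rewrite inE.
  apply: dominates_covers_min => y; rewrite mnmDE mnmE.
  by apply: leq_trans (geq_minl _ _) _; rewrite leq_add2l; case: eqP => // <-.
apply/exists_inP; apply: contraLR dom_bm; rewrite negb_exists_in => /forall_inP mA.
(* A monomial without variables of [A] adds exponents only where T has no flavor and [b] already
   equals s. *)
apply: contra ncol; apply: dominates_covers_min => i; rewrite mnmDE mnmE.
have [/mA|iA] := boolP (i \in A).
  by rewrite -eqn0Ngt => /eqP->; rewrite addn0 geq_minl.
suff -> : flavors T i = set0 by rewrite cards0; lia.
by apply/setP => j; rewrite !inE; apply: contraNF iA => /TA.
Qed.
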